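(* Let $G$ be a finite simple graph on $V(G)=\{1,\dots,n\}$, let $K$ be a field, let $T=K[s_i,t_i: i\in V(G)]$, and let $I\subset T$ be the monomial ideal of independent sets of $G$. Let the minimal monomial generators of $I$ be listed as $m_1\succ m_2\succ\cdots\succ m_q$, in decreasing order with respect to the order $\succ$ defined in the context, where $m_i=\prod_{r\in S_i}s_r\prod_{r\notin S_i}t_r$ and $S_1,\dots,S_q$ are all the independent sets of $G$. Then for all $i>1$, $$(m_1,\ldots,m_{i-1}):(m_i)=(t_r: r\in S_i).$$
   Context: Here $n\ge 1$. A set $S\subseteq V(G)$ is independent if no two elements of $S$ are adjacent in $G$ (the empty set is independent). The monomial ideal of independent sets of $G$ is the squarefree monomial ideal $I\subset T$ generated by the monomials $\prod_{r\in S}s_r\prod_{r\in V(G)\setminus S}t_r$, with $S$ ranging over all independent sets of $G$; these monomials are its minimal monomial generators. For such a generator $m_i$ write $m_i^{(s)}=\prod_{r\in S_i}s_r$ and $\deg_s(m_i)=\deg m_i^{(s)}=|S_i|$. Consider the lexicographic order on the monomials of $K[s_1,\dots,s_n]$ with $s_1>_{\mathrm{lex}}s_2>_{\mathrm{lex}}\cdots>_{\mathrm{lex}}s_n$. The order $\succ$ is defined by: $m_i\succ m_j$ if and only if either $\deg_s(m_i)<\deg_s(m_j)$, or $\deg_s(m_i)=\deg_s(m_j)$ and $m_i^{(s)}>_{\mathrm{lex}}m_j^{(s)}$. *)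

(* Defs.v *)
From mathcomp Require Import all_boot all_order all_algebra.
From mathcomp Require Import mpoly.

Set Implicit Arguments.
Unset Strict Implicit.
Unset Printing Implicit Defensive.

Import Order.TTheory GRing.Theory.
Local Open Scope ring_scope.

(* Ideals are Prop-valued predicates, because the ideal predicates of
   ring_quotient are boolean (decidable) and have no "generated by". *)
Section Ideals.
Variable R : comNzRingType.

Definition ideal_gen (X : R -> Prop) (p : R) : Prop :=
  exists (k : nat) (a x : 'I_k -> R),
    (forall i, X (x i)) /\ p = \sum_(i < k) a i * x i.

Definition ideal_colon (J L : R -> Prop) (p : R) : Prop :=
  forall r, L r -> J (p * r).

Definition ideal_eq (J L : R -> Prop) : Prop := forall p, J p <-> L p.

End Ideals.

Section MonomialIdeals.
Variables (K : fieldType) (k : nat).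

Definition monomial_ideal (X : 'X_{1..k} -> Prop) : {mpoly K[k]} -> Prop :=
  ideal_gen (fun p => exists2 u, X u & p = 'X_[u]).

Definition minimal_monomial_generators
    (I : {mpoly K[k]} -> Prop) (X : 'X_{1..k} -> Prop) : Prop :=
  ideal_eq (monomial_ideal X) I /\
  forall Y : 'X_{1..k} -> Prop,
    (forall u, Y u -> X u) -> ideal_eq (monomial_ideal Y) I ->
    forall u, X u -> Y u.

End MonomialIdeals.

(* T = K[s_r, t_r] is {mpoly K[n + n]}: the first n variables are the s_r,
   the last n are the t_r. *)
Definition s_var (K : fieldType) (n : nat) (r : 'I_n) : {mpoly K[n + n]} :=
  'X_(lshift n r).

Definition t_var (K : fieldType) (n : nat) (r : 'I_n) : {mpoly K[n + n]} :=
  'X_(rshift n r).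

Definition independent (n : nat) (e : rel 'I_n) (A : {set 'I_n}) : bool :=
  [forall x in A, forall y in A, ~~ e x y].

Definition indep_monomial (K : fieldType) (n : nat) (A : {set 'I_n}) :
    {mpoly K[n + n]} :=
  (\prod_(r in A) s_var K r) * (\prod_(r | r \notin A) t_var K r).

Definition indep_ideal (K : fieldType) (n : nat) (e : rel 'I_n) :
    {mpoly K[n + n]} -> Prop :=
  ideal_gen (fun p => exists2 A, independent e A & p = indep_monomial K A).
Arguments indep_ideal K {n} e _.

Definition s_part (n : nat) (u : 'X_{1..n + n}) : 'X_{1..n} :=
  [multinom u (lshift n r) | r < n].

Definition s_deg (n : nat) (u : 'X_{1..n + n}) : nat := mdeg (s_part u).

(* The order that mpoly puts on 'X_{1..n} compares total degrees first; here
   the exponent vectors are compared purely lexicographically, with the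
   variable of index 0 the largest. *)
Definition lex_gt (n : nat) (u v : 'X_{1..n}) : bool :=
  ((v : n.-tuplelexi nat) < (u : n.-tuplelexi nat))%O.

(* [mon_succ u v] is u \succ v: smaller s-degree comes first. *)
Definition mon_succ (n : nat) (u v : 'X_{1..n + n}) : bool :=
  (s_deg u < s_deg v)%N ||
  (s_deg u == s_deg v) && lex_gt (s_part u) (s_part v).

(* Main.v *)
Require Import Defs.
From mathcomp Require Import all_boot all_order all_algebra.
From mathcomp Require Import mpoly.

(** Membership in a monomial ideal, and in its colon by a monomial, can be
    tested one monomial at a time ([monomial_idealP], [monomial_colonP]).  Both
    sides of the theorem are thus decided by which monomials [u] they contain,
    and it is to be shown that [u * m_i] is divisible by some [m_j] with
    [j < i] exactly when [u] is divisible by some [t_r] with [r] in [S_i].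

    If [t_r] divides [u], remove [r] from [S_i]: what remains is again
    independent, hence equal to some [S_j].  It has fewer elements, so [j < i],
    and [m_j] divides [t_r * m_i] because [t_r * m_i = s_r * m_j].

    Conversely, [m_j] preceding [m_i] gives [#|S_j| <= #|S_i|] with
    [S_j != S_i], so there is some [r] in [S_i] outside [S_j]
    ([mon_succ_indep_expo]).  Then [t_r] divides [m_j] but not [m_i], and it
    must divide [u] as soon as [m_j] divides [u * m_i]. *)

Set Implicit Arguments.
Unset Strict Implicit.
Unset Printing Implicit Defensive.

Import GRing.Theory.
Local Open Scope ring_scope.

Lemma ideal_gen_sub (R : comNzRingType) (X Y : R -> Prop) (p : R) :
  (forall x, X x -> Y x) -> ideal_gen X p -> ideal_gen Y p.
Proof.
move=> XY [k [a [x [Xx ->]]]]; exists k, a, x.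
by split=> // i; apply/XY/Xx.
Qed.

Lemma ideal_gen_mull (R : comNzRingType) (X : R -> Prop) (b p : R) :
  ideal_gen X p -> ideal_gen X (b * p).
Proof.
move=> [k [a [x [Xx ->]]]]; exists k, (fun i => b * a i), x.
by split=> //; rewrite mulr_sumr; apply: eq_bigr => i _; rewrite mulrA.
Qed.

(** Testing the colon on the generator [x] alone suffices. *)
Lemma colon_principalP (R : comNzRingType) (X : R -> Prop) (x p : R) :
  ideal_colon (ideal_gen X) (ideal_gen (fun y => y = x)) p
  <-> ideal_gen X (p * x).
Proof.
split=> [|Xpx r [k [a [y [yx ->]]]]].
  apply; exists 1%N, (fun=> 1), (fun=> x).
  by split=> //; rewrite big_ord1 mul1r.
have -> : p * (\sum_(i < k) a i * y i) = (\sum_(i < k) a i) * (p * x).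
  rewrite mulrCA; congr (_ * _); rewrite mulr_suml.
  by apply: eq_bigr => i _; rewrite yx.
exact: ideal_gen_mull.
Qed.

(** Every term of a combination of generators is divisible by a generator, and
    no cancellation can create new monomials; conversely the expansion of [p]
    into its terms is itself a combination of the generators. *)
Lemma monomial_idealP (K : fieldType) (k : nat) (X : 'X_{1..k} -> Prop)
    (p : {mpoly K[k]}) :
  monomial_ideal X p
  <-> forall u, u \in msupp p -> exists2 v, X v & (v <= u)%MM.
Proof.
split=> [[l [a [x [Xx ->]]]] u /msupp_sum_le /flatten_mapP[i _]|divX].
  have [v Xv ->] := Xx i.
  by rewrite (perm_mem (msuppMX _ _)) => /mapP[w _ ->]; exists v;
    rewrite ?lem_addr.
pose u (i : 'I_(size (msupp p))) := nth 0%MM (msupp p) i.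
have [v Xv vu] : exists2 v : 'I_(size (msupp p)) -> 'X_{1..k},
    forall i, X (v i) & forall i, (v i <= u i)%MM.
  apply: (@fin_all_exists2 _ (fun=> 'X_{1..k}) (fun=> X)
                           (fun i v => (v <= u i)%MM)) => i.
  by apply: divX; apply: mem_nth.
exists (size (msupp p)), (fun i => p@_(u i) *: 'X_[u i - v i]),
  (fun i => 'X_[v i]).
split=> [i|]; first by exists (v i).
rewrite {1}[p]mpolyE (big_nth 0%MM) big_mkord; apply: eq_bigr => i _.
by rewrite -scalerAl -mpolyXD submK.
Qed.

Lemma monomial_colonP (K : fieldType) (k : nat) (X : 'X_{1..k} -> Prop)
    (w : 'X_{1..k}) (p : {mpoly K[k]}) :
  ideal_colon (monomial_ideal X) (ideal_gen (fun y => y = 'X_[w])) p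
  <-> forall u, u \in msupp p -> exists2 v, X v & (v <= w + u)%MM.
Proof.
split=> [/colon_principalP/monomial_idealP divX u pu | divX].
  by apply: divX; rewrite (perm_mem (msuppMX _ _)) map_f.
apply/colon_principalP/monomial_idealP => u.
by rewrite (perm_mem (msuppMX _ _)) => /mapP[z pz ->]; apply: divX.
Qed.

(** The exponent vector of [indep_monomial K A]: the variables [s_r] are indexed
    by the left summand of ['I_(n + n)], the [t_r] by the right one. *)
Definition indep_expo (n : nat) (A : {set 'I_n}) : 'X_{1..n + n} :=
  [multinom match split i with
            | inl r => r \in A
            | inr r => r \notin A
            end : nat | i < n + n].

Lemma indep_expo_s (n : nat) (A : {set 'I_n}) (r : 'I_n) :
  indep_expo A (lshift n r) = (r \in A).
Proof. by rewrite mnmE (unsplitK (inl r)). Qed.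

Lemma indep_expo_t (n : nat) (A : {set 'I_n}) (r : 'I_n) :
  indep_expo A (rshift n r) = (r \notin A).
Proof. by rewrite mnmE (unsplitK (inr r)). Qed.

Lemma indep_monomialE (K : fieldType) (n : nat) (A : {set 'I_n}) :
  indep_monomial K A = 'X_[indep_expo A].
Proof.
rewrite /indep_monomial mpolyXE_id big_split_ord /=; congr (_ * _); rewrite big_mkcond;
  apply: eq_bigr => r _.
- by rewrite indep_expo_s; case: (r \in A); rewrite ?expr1 ?expr0.
- by rewrite indep_expo_t; case: (r \in A); rewrite ?expr1 ?expr0.
Qed.

Lemma s_deg_indep_expo (n : nat) (A : {set 'I_n}) :
  s_deg (indep_expo A) = #|A|.
Proof.
rewrite /s_deg mdegE -sum1_card [RHS]big_mkcond; apply: eq_bigr => r _.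
by rewrite mnmE indep_expo_s; case: (r \in A).
Qed.

Lemma mon_succ_irr (n : nat) : irreflexive (@mon_succ n).
Proof.
by move=> u; rewrite /mon_succ /lex_gt ltnn Order.POrderTheory.ltxx andbF.
Qed.

(** Otherwise [B \subset A], which together with [#|A| <= #|B|] forces
    [A = B]; but the order is strict. *)
Lemma mon_succ_indep_expo (n : nat) (A B : {set 'I_n}) :
  mon_succ (indep_expo A) (indep_expo B) -> exists2 r, r \in B & r \notin A.
Proof.
move=> AB; apply/subsetPn/negP => sBA.
have leAB : (#|A| <= #|B|)%N.
  move: AB; rewrite /mon_succ !s_deg_indep_expo.
  by case/orP=> [/ltnW|/andP[/eqP->]].
have eqBA : B = A by apply/eqP; rewrite eqEcard sBA.
by rewrite eqBA mon_succ_irr in AB.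
Qed.

Lemma independentS (n : nat) (e : rel 'I_n) (A B : {set 'I_n}) :
  A \subset B -> independent e B -> independent e A.
Proof.
move=> /subsetP sAB /forall_inP indB.
apply/forall_inP => x /sAB /indB /forall_inP indBx.
by apply/forall_inP => y /sAB; apply: indBx.
Qed.

(** This is [t_r * m_A = s_r * m_(A :\ r)] when [r] is in [A], with [t_r]
    dividing [u]; when it is not, [A :\ r = A]. *)
Lemma indep_expo_setD1_le (n : nat) (A : {set 'I_n}) (r : 'I_n)
    (u : 'X_{1..n + n}) :
  u (rshift n r) != 0%N -> (indep_expo (A :\ r) <= indep_expo A + u)%MM.
Proof.
move=> ur; apply/mnm_lepP => i; rewrite mnmDE -(splitK i).
case: (split i) => x /=; rewrite ?indep_expo_s ?indep_expo_t in_setD1.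
  by case: (x \in A); rewrite ?andbF //= andbT; case: (x != r).
have [-> /= | _] := eqVneq x r; last exact: leq_addr.
by rewrite addn_gt0 orbC lt0n ur.
Qed.

Theorem theorem2p2 (n : nat) (n_ge1 : (1 <= n)%N)
    (e : rel 'I_n) (e_sym : ssrbool.symmetric e) (e_irr : irreflexive e)
    (K : fieldType)
    (q : nat) (m : 'I_q -> 'X_{1..n + n}) (S_ : 'I_q -> {set 'I_n})
    (m_min_gens : minimal_monomial_generators (indep_ideal K e)
                    (fun u => exists i, m i = u))
    (m_decr : forall i j : 'I_q, (i < j)%N -> mon_succ (m i) (m j))
    (m_def : forall i : 'I_q, 'X_[m i] = indep_monomial K (S_ i))
    (S_indep : forall A : {set 'I_n},
                 independent e A <-> exists i, S_ i = A) :
  forall i : 'I_q, (0 < i)%N ->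
    ideal_eq
      (ideal_colon
         (ideal_gen (fun p => exists2 j : 'I_q, (j < i)%N & p = 'X_[m j]))
         (ideal_gen (fun p => p = 'X_[m i])))
      (ideal_gen (fun p => exists2 r : 'I_n, r \in S_ i & p = t_var K r)).
Proof.
have mE j : m j = indep_expo (S_ j).
  have /(congr1 (fun p : {mpoly K[n + n]} => msupp p)) := m_def j.
  by rewrite indep_monomialE !msuppX => -[].
move=> i _ p.
pose X u := exists2 j : 'I_q, (j < i)%N & u = m j.
pose Y u := exists2 r : 'I_n, r \in S_ i & u = U_(rshift n r)%MM.
have colonX : ideal_colon
    (ideal_gen (fun p => exists2 j : 'I_q, (j < i)%N & p = 'X_[m j]))
    (ideal_gen (fun p => p = 'X_[m i])) p
  <-> ideal_colon (monomial_ideal X) (ideal_gen (fun p => p = 'X_[m i])) p.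
  split=> colon r /colon; apply: ideal_gen_sub => x.
    by case=> j ji ->; exists (m j) => //; exists j.
  by case=> u [j ji ->] ->; exists j.
have genY : ideal_gen (fun p => exists2 r : 'I_n, r \in S_ i & p = t_var K r) p
  <-> monomial_ideal Y p.
  split; apply: ideal_gen_sub => x.
    by case=> r ri ->; exists U_(rshift n r)%MM => //; exists r.
  by case=> u [r ri ->] ->; exists r.
split=> [/colonX/monomial_colonP divX | /genY/monomial_idealP divY].
  apply/genY/monomial_idealP => u /divX[_ [j ji ->]] /mnm_lepP mju.
  move: (m_decr _ _ ji); rewrite !mE => /mon_succ_indep_expo[r ri rj].
  exists U_(rshift n r)%MM; first by exists r.
  (* At the variable t_r the exponents of m_j and m_i are 1 and 0. *)
  move: (mju (rshift n r)).
  by rewrite lep1mP mnmDE !mE !indep_expo_t ri rj -lt0n.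
apply/colonX/monomial_colonP => u /divY[_ [r ri ->]]; rewrite lep1mP => ur.
have [j Sj] : exists j, S_ j = S_ i :\ r.
  apply/S_indep; apply: (independentS (subsetDl _ _)).
  by apply/S_indep; exists i.
exists (m j); last by rewrite !mE Sj indep_expo_setD1_le.
have lt_card : (#|S_ j| < #|S_ i|)%N by rewrite Sj [ltnRHS](cardsD1 r) ri.
(* A smaller set comes earlier in the listing. *)
exists j => //; case: (ltngtP j i) => // [/m_decr|/val_inj ji].
  rewrite !mE /mon_succ !s_deg_indep_expo ltnNge (ltnW lt_card) /=.
  by rewrite gtn_eqF.
by rewrite ji ltnn in lt_card.
Qed.
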